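(* Let $P$ be a bounded poset and let $\mathcal S$ be the collection of all full separating subsets $A\subset P^*$ for which $\mathbf C_{1,A}=\mathbf C_{2,A}$. Then all orthocomplementations on $P$ are in one-to-one correspondence with the maximal (with respect to set inclusion) elements of $\mathcal S$, the correspondence being given by assigning to a maximal element $A\in\mathcal S$ the orthocomplementation $(\cdot)'^{A}$ associated with $A$.
   Context: An orthocomplementation on a bounded poset $P$ (with least element $0$ and greatest element $1$) is an order-reversing map $(\cdot)':P\to P$ such that for all $p$: $(p')'=p$, the join $p\vee p'$ exists and equals $1$, and the meet $p\wedge p'$ exists and equals $0$. For a poset $P$, $P^*$ denotes the set of all isotone (order-preserving) maps from $P$ to $\mathbf 2=\{0,1\}$ with $0<1$. A closure on a set $M$ is a map $\mathbf C:\exp(M)\to\exp(M)$ on subsets of $M$ with $X\subset\mathbf C(X)$, $\mathbf C(\mathbf C(X))=\mathbf C(X)$, and $X\subset Y\Rightarrow\mathbf C(X)\subset\mathbf C(Y)$. A set $X$ is closed if $X=\mathbf C(X)$ and open if $M\setminus X$ is closed. For $\mathcal K\subset\exp(M)$, $\mathrm{clos}(\mathcal K)$ is the closure whose closed sets are exactly the intersections of subfamilies of $\mathcal K$ (the empty intersection being $M$). For two closures $\mathbf C_1,\mathbf C_2$ on $M$, $\mathrm{C}_1\mathrm{O}_2(M,\mathbf C_1,\mathbf C_2)$ is the collection of all subsets of $M$ that are both $\mathbf C_1$-closed and $\mathbf C_2$-open, ordered by inclusion. For $A\subset P^*$ and $p\in P$ put $\mathcal{UP}_A(p)=\{x\in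 A: x(p)=1\}$ and $\mathcal{LO}_A(p)=\{x\in A: x(p)=0\}$, and let $\mathbf C_{1,A}=\mathrm{clos}\{\mathcal{UP}_A(p)\}_{p\in P}$, $\mathbf C_{2,A}=\mathrm{clos}\{\mathcal{LO}_A(p)\}_{p\in P}$ be closures on $A$. An $A$-ideal is a subset of $P$ of the form $\bigcap_{x\in B}x^{-1}(0)$ with $B\subset A$; an $A$-filter is a subset of the form $\bigcap_{x\in B}x^{-1}(1)$ with $B\subset A$. Here $B=\emptyset$ is allowed and gives $P$. $A$ is full if for all $p,q\in P$ with $p\not\leq q$ there is $x\in A$ with $x(p)=1$, $x(q)=0$. $A$ is separating if for any disjoint $A$-ideal $I$ and $A$-filter $F$ there is $x\in A$ with $x|_I=0$ and $x|_F=1$. For $A$ full and separating, $p\mapsto\mathcal{UP}_A(p)$ is an order isomorphism from $P$ onto $\mathrm{C}_1\mathrm{O}_2(A,\mathbf C_{1,A},\mathbf C_{2,A})$. For $A\in\mathcal S$, this collection is closed under set complementation $X\mapsto A\setminus X$, and $(\cdot)'^{A}$ denotes the orthocomplementation on $P$ obtained by transporting set complementation along this isomorphism, i.e. $p'^{A}$ is the unique element of $P$ with $\mathcal{UP}_A(p'^{A})=A\setminus\mathcal{UP}_A(p)$. *)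

(* Defs.v *)
From HB Require Import structures.
From mathcomp Require Import all_boot all_order all_classical.

Set Implicit Arguments.
Unset Strict Implicit.
Unset Printing Implicit Defensive.

Import Order.Theory.
Local Open Scope classical_set_scope.

Section Closures.
Variable M : Type.
Implicit Types (C : set M -> set M) (K : set (set M)) (X : set M).

Definition is_closure C : Prop :=
  [/\ forall X, X `<=` C X,
      forall X, C (C X) = C X
    & forall X Y, X `<=` Y -> C X `<=` C Y].

Definition closed_in C X : Prop := X = C X.

(* [smallest K X] is the intersection of all members of [K] containing [X]; no
   such member gives [setT]. [clos_is_closure] and [closed_in_closP] show that
   it is the closure whose closed sets are the intersections of subfamilies of
   [K]. *)
Definition clos K : set M -> set M := smallest K.

Lemma clos_is_closure K : is_closure (clos K).
Proof.
have sub X : X `<=` clos K X by move=> x Xx Y [_ XY]; exact: XY.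
split=> // [X|X Y XY x cXx Z [KZ YZ]]; last first.
  by apply: (cXx Z); split=> //; apply: subset_trans YZ.
apply/seteqP; split=> //.
by move=> x ccx Y [KY XY]; apply: (ccx Y); split=> // y cy; exact: (cy Y).
Qed.

Lemma closed_in_closP K X :
  closed_in (clos K) X <-> exists2 F, F `<=` K & X = \bigcap_(Y in F) Y.
Proof.
split=> [->|[F FK ->]]; first by exists [set Y | K Y /\ X `<=` Y] => // Y [].
apply/seteqP; split; first by have [sub _ _] := clos_is_closure K; exact: (sub _).
by move=> x cx Y FY; apply: (cx Y); split; [exact: FK|move=> z Fz; exact: (Fz Y FY)].
Qed.

End Closures.

(* [P^*]: the isotone maps from [P] to [bool], ordered by [false < true]. *)
Definition Pstar (d : Order.disp_t) (P : porderType d) : Type :=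
  {omorphism P -> bool}.

Section Representation.
Variables (d : Order.disp_t) (P : porderType d).
Implicit Types (A B : set (Pstar P)) (p q : P) (I F : set P).

(* [A] coerces to the type of its elements, so [UP A p], [LO A p] are subsets of
   [A] and [~`] is the complement relative to [A]. *)
Definition UP A p : set A := [set x : A | \val x p = true].
Definition LO A p : set A := [set x : A | \val x p = false].
Arguments UP : clear implicits.
Arguments LO : clear implicits.

Definition C1 A : set A -> set A := clos (range (UP A)).
Definition C2 A : set A -> set A := clos (range (LO A)).
Arguments C1 : clear implicits.
Arguments C2 : clear implicits.

Definition A_ideal A I : Prop :=
  exists2 B, B `<=` A & I = \bigcap_(x in B) [set p | x p = false].

Definition A_filter A F : Prop :=
  exists2 B, B `<=` A & F = \bigcap_(x in B) [set p | x p = true].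

Definition full A : Prop :=
  forall p q, ~~ (p <= q)%O -> exists x, [/\ A x, x p = true & x q = false].

Definition separating A : Prop :=
  forall I F, A_ideal A I -> A_filter A F -> I `&` F = set0 ->
  exists x, [/\ A x, forall p, I p -> x p = false
                   & forall p, F p -> x p = true].

Definition calS : set (set (Pstar P)) :=
  [set A | [/\ full A, separating A & C1 A = C2 A]].

Definition maximal_calS : set (set (Pstar P)) :=
  [set A | calS A /\ forall B, calS B -> A `<=` B -> B = A].

(* The element [p'] with [UP A p' = ~` UP A p], unique when [A] is full; the
   default value [p] is used only if there is none, which does not happen for
   [A] in [calS]. *)
Definition associated_ortho A : P -> P :=
  fun p => xget p [set q | UP A q = ~` UP A p].

End Representation.

Arguments UP {d P} A p _.
Arguments LO {d P} A p _.
Arguments C1 {d P} A _ _.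
Arguments C2 {d P} A _ _.
Arguments maximal_calS {d} P _.

Definition orthocomplementation (d : Order.disp_t) (P : tbPOrderType d)
    (c : P -> P) : Prop :=
  [/\ {homo c : p q /~ (p <= q)%O},
      involutive c,
      forall p, supremums [set p; c p] \top%O
    & forall p, infimums [set p; c p] \bot%O].

(* Main.v *)
Require Import Defs.
From HB Require Import structures.
From mathcomp Require Import all_boot all_order all_classical.

Set Implicit Arguments.
Unset Strict Implicit.
Unset Printing Implicit Defensive.

Import Order.Theory.
Local Open Scope classical_set_scope.

(** The inverse correspondence sends an orthocomplementation [c] to the set
    [ortho_maps c] of all isotone maps [x] with [x (c p) = ~~ x p]. This set
    lies in [calS]: call a subset of [P] consistent if it contains no [p], [q]
    with [p <= c q]; by Zorn's lemma every nonempty consistent set extends to a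
    maximal one, which is [x^-1(1)] for some [x] in [ortho_maps c]. Fullness
    and separation apply this to [{p, c q}] and to the union of [F] and [c I].
    Conversely a member [A] of [calS] is contained in [ortho_maps] of its
    associated orthocomplementation, so the maximal members are exactly the
    sets [ortho_maps c]. *)

(** * Sets of isotone maps on an arbitrary poset *)

Section Representation.
Variables (d : Order.disp_t) (P : porderType d).
Implicit Types (A : set (Pstar P)) (p q : P).

Lemma UP_setC_val A p q x :
  UP A p = ~` UP A q -> A x -> x p = ~~ x q.
Proof.
move=> UPE Ax; pose y : A := exist _ x (mem_set Ax).
have := congr1 (fun X => X y) UPE; rewrite /UP /setC /= propeqE.
case: (x p); case: (x q) => // -[pq qp]; last exact: qp.
by have /(_ erefl) := pq erefl.
Qed.

Lemma full_le A p q :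
  full A -> (forall x, A x -> x p = true -> x q = true) -> (p <= q)%O.
Proof.
move=> fullA pq; case: (boolP (p <= q)%O) => // /fullA [x [Ax /(pq _ Ax) ->]].
by [].
Qed.

Lemma full_inj A p q :
  full A -> (forall x, A x -> x p = x q) -> p = q.
Proof.
by move=> fullA pq; apply/eqP; rewrite eq_le;
  apply/andP; split; apply: (full_le fullA) => x Ax; rewrite pq.
Qed.

Lemma separating_clopen A (X : set A) :
  separating A -> closed_in (C1 A) X -> closed_in (C2 A) (~` X) ->
  exists p, UP A p = X.
Proof.
move=> sepA /closed_in_closP[F FK XF] /closed_in_closP[G GK XG].
pose I := \bigcap_(x in \val @` (~` X)) [set p | (x : Pstar P) p = false].
pose J := \bigcap_(x in \val @` X) [set p | (x : Pstar P) p = true].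
have subA (Y : set A) : \val @` Y `<=` A by move=> _ [y _ <-]; exact/set_mem/valP.
have : I `&` J !=set0.
  apply/set0P/eqP => IJ.
  have [||x [Ax xI xJ]] := sepA I J _ _ IJ;
    [by exists (\val @` (~` X))|by exists (\val @` X)|].
  pose y : A := exist _ x (mem_set Ax).
  have Xy : X y.
    rewrite XF => Y FY; have [p _ Yp] := FK _ FY; rewrite -Yp.
    apply: xJ => _ [z Xz <-].
    by move: Xz; rewrite XF => /(_ _ FY); rewrite -Yp.
  suff : (~` X) y by [].
  rewrite XG => Y GY; have [p _ Yp] := GK _ GY; rewrite -Yp.
  apply: xI => _ [z Xz <-].
  by move: Xz; rewrite XG => /(_ _ GY); rewrite -Yp.
move=> [p [Ip Jp]]; exists p; apply/seteqP; split=> x xp.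
  by apply: contrapT => nXx; have := Ip _ (ex_intro2 _ _ x nXx erefl); rewrite /= xp.
exact: Jp _ (ex_intro2 _ _ x xp erefl).
Qed.

(** The complement of [UP A p] is [LO A p], which is [C2]-closed and so, as [C1 A = C2 A], also
    [C1]-closed; likewise [UP A p] is [C2]-closed. *)
Lemma associated_orthoP A :
  calS A -> forall p, UP A (associated_ortho A p) = ~` UP A p.
Proof.
move=> [_ sepA C12] p; rewrite /associated_ortho.
have LOE : ~` UP A p = LO A p.
  by apply/seteqP; split=> x; rewrite /UP /LO /setC /=; case: (\val x p).
suff : exists q, UP A q = ~` UP A p by exact: xgetPex.
apply: separating_clopen => //.
  rewrite C12 LOE; apply/closed_in_closP.
  by exists [set LO A p]; rewrite ?bigcap_set1// => _ ->; exists p.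
rewrite -C12 setCK; apply/closed_in_closP.
by exists [set UP A p]; rewrite ?bigcap_set1// => _ ->; exists p.
Qed.

Lemma associated_orthoE A x p :
  calS A -> A x -> x (associated_ortho A p) = ~~ x p.
Proof. by move=> SA; apply/UP_setC_val/associated_orthoP. Qed.

Definition ortho_maps (c : P -> P) : set (Pstar P) :=
  [set x | forall p, x (c p) = ~~ x p].

Lemma associated_ortho_eq A (c : P -> P) :
  calS A -> A `<=` ortho_maps c -> associated_ortho A = c.
Proof.
move=> SA Ac; have [fullA _ _] := SA; apply/funext => p.
by apply: (full_inj fullA) => x Ax; rewrite associated_orthoE// Ac.
Qed.

(** The involution [c] exchanges the two generating families: [UP A (c p) = LO A p]. *)
Lemma C12_ortho_maps (c : P -> P) :
  involutive c -> C1 (ortho_maps c) = C2 (ortho_maps c).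
Proof.
move=> cK; set A := ortho_maps c.
have UPc p : UP A (c p) = LO A p.
  apply/seteqP; rewrite /UP /LO.
  by split=> x /=; have /set_mem -> := valP x; case: (\val x p).
rewrite /C1 /C2; congr clos; apply/seteqP; split=> _ [p _ <-].
  by exists (c p) => //; rewrite -UPc cK.
by exists (c p).
Qed.

End Representation.

(** * Orthocomplementations of a bounded poset *)

Section Orthocomplementations.
Variables (d : Order.disp_t) (P : tbPOrderType d).
Implicit Types (A : set (Pstar P)) (c : P -> P) (p q : P).

Lemma associated_ortho_orthocomplementation A :
  calS A -> orthocomplementation (associated_ortho A).
Proof.
move=> SA; have [fullA _ _] := SA; set c := associated_ortho A.
have cE x p : A x -> x (c p) = ~~ x p by exact: associated_orthoE.
split=> [p q pq|p|p|p].
- apply: (full_le fullA) => x Ax; rewrite !cE//.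
  by have := omorph_le x pq; case: (x p); case: (x q).
- by apply: (full_inj fullA) => x Ax; rewrite !cE// negbK.
- split=> [q _|r rub]; first exact: lex1.
  have pr : (p <= r)%O by apply: rub; left.
  have cpr : (c p <= r)%O by apply: rub; right.
  (* Each [x] in [A] is 1 at [p] or at [c p], hence at [r]. *)
  apply: (full_le fullA) => x Ax _.
  have := omorph_le x pr; have := omorph_le x cpr.
  by rewrite cE//; case: (x p); case: (x r).
- split=> [q _|r rlb]; first exact: le0x.
  have rp : (r <= p)%O by apply: rlb; left.
  have rcp : (r <= c p)%O by apply: rlb; right.
  apply: (full_le fullA) => x Ax.
  have := omorph_le x rp; have := omorph_le x rcp.
  by rewrite cE//; case: (x p); case: (x r).
Qed.

(** A necessary condition for some [x] in [ortho_maps c] to be 1 on all of [U]; the case [p = q] is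
    included. *)
Definition consistent c (U : set P) :=
  forall p q, U p -> U q -> ~~ (p <= c q)%O.

Section FixedOrthocomplementation.
Variable c : P -> P.
Hypothesis orthoc : orthocomplementation c.

Lemma ortho_homo p q : (p <= q)%O -> (c q <= c p)%O.
Proof. by have [+ _ _ _] := orthoc => + pq; apply. Qed.

Lemma orthoK : involutive c.
Proof. by have [] := orthoc. Qed.

Lemma ortho_leC p q : (p <= c q)%O -> (q <= c p)%O.
Proof. by move=> /ortho_homo; rewrite orthoK. Qed.

Lemma le_ortho_bot p q : (p <= c p)%O -> (p <= q)%O.
Proof.
move=> pcp; apply: le_trans (le0x q); have [_ _ _ /(_ p)[_]] := orthoc.
by apply=> _ [->|->].
Qed.

Lemma consistent_extend (U : set P) : consistent c U -> U !=set0 ->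
  exists2 x, ortho_maps c x & forall p, U p -> x p = true.
Proof.
move=> consU [u Uu].
(* Ordering the added parts [V], not the supersets of [U], makes the empty chain harmless: its union
   [set0] is admissible because [U] is consistent. *)
have [|V [consV maxV]] := @Zorn_bigcup P [set V | consistent c (U `|` V)].
  move=> F FC totF p q [Up|[V FV Vp]] [Uq|[W FW Wq]].
  - exact: consU.
  - by apply: (FC _ FW); [left|right].
  - by apply: (FC _ FV); [right|left].
  - have [VW|WV] := totF _ _ FV FW.
      by apply: (FC _ FW); right => //; exact: VW.
    by apply: (FC _ FV); right => //; exact: WV.
pose M := U `|` V.
have Madd t : ~~ (t <= c t)%O -> (forall p, M p -> ~~ (t <= c p)%O) -> M t.
  move=> tt tM; apply: contrapT => nMt.
  apply: (maxV (V `|` [set t])).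
    split; first exact: subsetUl.
    by move=> /(_ t (or_intror erefl)) Vt; apply: nMt; right.
  move=> p q; rewrite setUA => -[Mp|->] [Mq|->] //; first exact: consV.
    by apply: contra (tM _ Mp); exact: ortho_leC.
  exact: tM.
have Mup p q : (p <= q)%O -> M p -> M q.
  move=> pq Mp; apply: Madd => [|r Mr].
    apply: contra (consV _ _ Mp Mp) => qcq.
    exact: le_trans pq (le_trans qcq (ortho_homo pq)).
  by apply: contra (consV _ _ Mp Mr); exact: le_trans.
have Mortho p : M (c p) = ~ M p.
  rewrite propeqE; split=> [Mcp Mp|nMp].
    by have := consV _ _ Mcp Mp; rewrite lexx.
  apply: contrapT => nMcp; apply: nMp; apply: Madd => [|q Mq].
    (* Nonemptiness of [U] enters here: [p <= c p] forces [p <= c u], so [u <= c p] and [c p] is in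
       [M]. *)
    apply/negP => pcp; apply: nMcp; apply: (Mup u); last by left.
    by apply: ortho_leC; exact: le_ortho_bot.
  by apply/negP => /ortho_leC qcp; exact: nMcp (Mup _ _ qcp Mq).
pose f p := `[< M p >].
have f_homo : {homo f : p q / (p <= q)%O}.
  move=> p q pq; rewrite /f; case: asboolP => // Mp; case: asboolP => // nMq.
  by case: nMq; exact: Mup Mp.
pose fM := Order.isOrderMorphism.Build d P _ bool f f_homo.
pose x : {omorphism P -> bool} := HB.pack f fM.
exists x => p /=; rewrite /f; last by move=> Up; apply/asboolP; left.
by rewrite Mortho asbool_neg.
Qed.

Lemma full_ortho_maps : full (ortho_maps c).
Proof.
move=> p q npq.
have [||x xc xU] := @consistent_extend [set p; c q].
(* Each of the four possible clashes would give [p <= q]. *)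
- move=> _ _ [->|->] [->|->]; apply: contra npq.
  + exact: le_ortho_bot.
  + by rewrite orthoK.
  + by move=> /ortho_leC; rewrite orthoK.
  + by move=> /(le_ortho_bot (c p))/ortho_leC; rewrite orthoK.
- by exists p; left.
- exists x; split=> //; first by apply: xU; left.
  by have := xc q; rewrite xU; [case: (x q)|right].
Qed.

Lemma separating_ortho_maps : separating (ortho_maps c).
Proof.
move=> I F [BI BIc IE] [BF BFc FE] IF0.
have disj p : I p -> ~ F p by move=> Ip Fp; rewrite -[False]/(set0 p) -IF0.
have Idown p q : (p <= q)%O -> I q -> I p.
  rewrite IE => pq Iq x Bx /=; have := omorph_le x pq.
  by rewrite (Iq x Bx); case: (x p).
have Fup p q : (p <= q)%O -> F p -> F q.
  rewrite FE => pq Fp x Bx /=; have := omorph_le x pq.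
  by rewrite (Fp x Bx); case: (x q).
have xb x : ortho_maps c x -> x \bot%O = false /\ x \top%O = true.
  move=> xc; have := xc \bot%O.
  have := omorph_le x (le0x (c \bot%O)); have := omorph_le x (lex1 (c \bot%O)).
  by case: (x \bot%O); case: (x (c \bot%O)); case: (x \top%O).
have I0 : I \bot%O by rewrite IE => x /BIc /xb [].
have F1 : F \top%O by rewrite FE => x /BFc /xb [].
(* No map in [BF] is 1 at both [p] and [c p], so [BF] would be empty and [F] all of [P], meeting [I]
   at the bottom. The next claim is dual. *)
have Fc p : F p -> ~ F (c p).
  move=> Fp Fcp; apply: (disj _ I0); rewrite FE => x Bx.
  move: Fp Fcp; rewrite FE => /(_ x Bx) /= + /(_ x Bx) /=.
  by rewrite BFc// => ->.
have Ic p : I p -> ~ I (c p).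
  move=> Ip Icp; apply: disj F1; rewrite IE => x Bx.
  move: Ip Icp; rewrite IE => /(_ x Bx) /= + /(_ x Bx) /=.
  by rewrite BIc// => ->.
(* As [c] is an involution, [I (c p)] says that [p] lies in the image of [I] under [c]. *)
have [||x xc xU] := @consistent_extend [set p | F p \/ I (c p)].
- move=> p q /= [Fp|Ip] [Fq|Iq]; apply/negP => pq.
  + exact: Fc Fq (Fup _ _ pq Fp).
  + exact: disj (Idown _ _ pq Iq) Fp.
  + exact: disj (Idown _ _ (ortho_leC pq) Ip) Fq.
  + exact: Ic (Idown _ _ pq Iq) Ip.
- by exists \top%O; left.
- exists x; split=> // p => [Ip|Fp]; last by apply: xU; left.
  have : x (c p) = true by apply: xU; right; rewrite orthoK.
  by rewrite xc; case: (x p).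
Qed.

Lemma calS_ortho_maps : calS (ortho_maps c).
Proof.
split; [exact: full_ortho_maps|exact: separating_ortho_maps|].
exact/C12_ortho_maps/orthoK.
Qed.

(** On a larger [B] in [calS], [associated_ortho B] and [c] take the same values under every map of
    [ortho_maps c]. This set is full, so it tells points apart: the two coincide, and [B] lies in
    [ortho_maps c]. *)
Lemma maximal_ortho_maps : maximal_calS P (ortho_maps c).
Proof.
split=> [|B SB cB]; first exact: calS_ortho_maps.
apply/seteqP; split=> // x Bx p.
suff <- : associated_ortho B = c by exact: associated_orthoE.
have [fullB _ _] := SB; apply/funext => q.
apply: (full_inj full_ortho_maps) => y yc.
by rewrite yc (associated_orthoE _ SB)//; exact: cB.
Qed.

End FixedOrthocomplementation.

(** This recovers a maximal [A] from its orthocomplementation, whence injectivity of the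
    correspondence. *)
Lemma maximal_calSE A :
  maximal_calS P A -> A = ortho_maps (associated_ortho A).
Proof.
move=> [SA maxA]; apply/esym/maxA.
  exact/calS_ortho_maps/associated_ortho_orthocomplementation.
by move=> x Ax p; exact: associated_orthoE.
Qed.

End Orthocomplementations.

Theorem theorem8 (d : Order.disp_t) (P : tbPOrderType d) :
  (forall A : set (Pstar P), calS A ->
     forall p : P, UP A (associated_ortho A p) = ~` UP A p) /\
  set_bij (maximal_calS P)
          [set c : P -> P | orthocomplementation c]
          (fun A : set (Pstar P) => associated_ortho A).
Proof.
split=> [|]; first exact: associated_orthoP.
split=> [A [SA _]|A B|c orthoc].
- exact: associated_ortho_orthocomplementation.
- rewrite !inE => maxA maxB AB.
  by rewrite (maximal_calSE maxA) AB -maximal_calSE.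
- exists (ortho_maps c); first exact: maximal_ortho_maps.
  by apply: associated_ortho_eq => //; exact: calS_ortho_maps.
Qed.
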